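(* Let $\mathcal{O}p_{\mathcal{C}om}$ be the category of (unitary) operads $\mathcal P$ over $\Bbbk$ equipped with a morphism $\mathcal{C}om\to\mathcal P$. (1) For every sequence of non-negative integers $\mathbf d=\{d_1,d_2,\dots\}$, there is an operad $\mathcal P$ in $\mathcal{O}p_{\mathcal{C}om}$ such that its signature satisfies $\mathcal S(\mathcal P)=\mathbf d$. (2) The exponent $\exp$ is a surjective map from (the objects of) $\mathcal{O}p_{\mathcal{C}om}$, or from (the objects of) the category of 2-unitary operads, to $\{1\}\cup[2,\infty]$; that is, in either case $\exp$ takes values in $\{1\}\cup[2,\infty]$ and every element of this set is attained.
   Context: Fix a field $\Bbbk$; all operads are $\Bbbk$-linear symmetric operads (right $\mathbb S_n$-action on $\mathcal P(n)$, identity $\mathbf 1=\mathbf 1_1\in\mathcal P(1)$, compositions $\theta\circ(\theta_1,\dots,\theta_n)$ with the usual unit, associativity and equivariance axioms). $\mathcal P$ is unitary if $\mathcal P(0)=\Bbbk\mathbf 1_0\cong\Bbbk$; 2-unitary if it is unitary and there is $\mathbf 1_2\in\mathcal P(2)$ with $\mathbf 1_2\circ(\mathbf 1_0,\mathbf 1)=\mathbf 1=\mathbf 1_2\circ(\mathbf 1,\mathbf 1_0)$. $\mathcal{C}om$ is the operad of unital commutative algebras ($\mathcal{C}om(n)=\Bbbk$ for all $n\ge0$). Objects of $\mathcal{O}p_{\mathcal{C}om}$ are morphisms of operads $f:\mathcal{C}om\to\mathcal P$ and its morphisms are the commutative triangles; every such $\mathcal P$ is 2-unitary with the $\mathbf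 1_0,\mathbf 1_2$ inherited from $\mathcal{C}om$. Truncations: let $[n]=\{1,\dots,n\}$. For unitary $\mathcal P$ and $I\subseteq[n]$ with characteristic function $\chi_I$, $\pi^I:\mathcal P(n)\to\mathcal P(|I|)$, $\pi^I(\theta)=\theta\circ(\mathbf 1_{\chi_I(1)},\dots,\mathbf 1_{\chi_I(n)})$. For $k\ge1$, ${}^k\Upsilon(n)=\bigcap_{I\subseteq[n],|I|=k-1}\ker\pi^I$ if $n\ge k$ and $0$ if $n<k$. The signature of $\mathcal P$ is the sequence $\mathcal S(\mathcal P)=\{d_1,d_2,d_3,\dots\}$ with $d_k=\dim_\Bbbk{}^k\Upsilon(k)$ for $k\ge1$. The exponent of $\mathcal P$ is $\exp(\mathcal P)=\limsup_{n\to\infty}(\dim_\Bbbk\mathcal P(n))^{1/n}$; when it is discussed, $\mathcal P$ is implicitly assumed locally finite ($\dim_\Bbbk\mathcal P(n)<\infty$ for all $n$). *)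

(* Defs.v *)
From HB Require Import structures.
From mathcomp Require Import all_boot all_order all_fingroup all_algebra.
From mathcomp Require Import all_classical all_reals all_analysis.

Set Implicit Arguments.
Unset Strict Implicit.
Unset Printing Implicit Defensive.

Import Order.TTheory GRing.Theory Num.Theory.
Local Open Scope ring_scope.

(* Positions in a composite of arity m 0 + ... + m (n-1) are elements of
   'I_(\sum_i m i); Order's tagnat.Rank i j is the j-th position of the i-th
   block, blocks being laid out consecutively (tagnat.RankEsum), and
   tagnat.sig1, tagnat.sig2 recover i and j. *)

Lemma sum_Rank n (m : 'I_n -> nat) (l : 'I_(\sum_i m i)%N -> nat) :
  (\sum_i \sum_(j < m i) l (tagnat.Rank i j) = \sum_p l p)%N.
Proof.
rewrite sig_big_dep /= [RHS](reindex tagnat.rank) /=; last first.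
  exact/onW_bij/tagnat.rank_bij.
by apply: eq_bigr => -[i j] _; rewrite tagnat.rankE.
Qed.

Lemma sum_ones n : (\sum_(i < n) 1 = n)%N.
Proof. by rewrite sum1_card card_ord. Qed.

Lemma sum_single n : (\sum_(i < 1) n = n)%N.
Proof. by rewrite big_ord1. Qed.

Lemma sum_mem n (I : {set 'I_n}) : (\sum_(i < n) (i \in I) = #|I|)%N.
Proof. by rewrite -sum1_card [RHS]big_mkcond; apply: eq_bigr => i _; case: (i \in I). Qed.

Lemma sum_delta n (i0 : 'I_n) : (\sum_(i < n) (i == i0) = 1)%N.
Proof.
by rewrite (bigD1 i0) //= eqxx big1 ?addn0 // => i /negbTE ->.
Qed.

Lemma sum_permV n (s : 'S_n) (m : 'I_n -> nat) :
  (\sum_i m (s^-1%g i) = \sum_i m i)%N.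
Proof. by rewrite [RHS](reindex_inj (@perm_inj _ s^-1%g)). Qed.

(* The permutation s_(m_1,...,m_n) moving the i-th block, of size m i, to the
   s(i)-th block of the layout whose i-th block has size m (s^-1 i). *)
Section BlockPerm.
Variables (n : nat) (s : 'S_n) (m : 'I_n -> nat).

Lemma block_size_eq i : m i = m (s^-1%g (s i)).
Proof. by rewrite permK. Qed.

Definition block_perm_fun (p : 'I_(\sum_i m i)%N) : 'I_(\sum_i m i)%N :=
  cast_ord (sum_permV s m)
    (@tagnat.Rank n (fun i => m (s^-1%g i)) (s (tagnat.sig1 p))
       (cast_ord (block_size_eq (tagnat.sig1 p)) (tagnat.sig2 p))).

Lemma block_perm_inj : injective block_perm_fun.
Proof.
move=> p q /cast_ord_inj /(congr1 val) /eqP.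
rewrite /= tagnat.eq_Rank /= => /andP[/eqP /perm_inj e1 e2].
rewrite -(tagnat.sig2K p) -(tagnat.sig2K q); apply/val_inj/eqP => /=.
by rewrite tagnat.eq_Rank; apply/andP; split; first exact/eqP.
Qed.

Definition block_perm : 'S_(\sum_i m i)%N := perm block_perm_inj.

End BlockPerm.

(* The permutation t_1 + ... + t_n acting by t i inside the i-th block. *)
Section SumPerm.
Variables (n : nat) (m : 'I_n -> nat) (t : forall i, 'S_(m i)).

Definition sum_perm_fun (p : 'I_(\sum_i m i)%N) : 'I_(\sum_i m i)%N :=
  tagnat.Rank (tagnat.sig1 p) (t (tagnat.sig1 p) (tagnat.sig2 p)).

Lemma sum_perm_inj : injective sum_perm_fun.
Proof.
move=> p q; rewrite /sum_perm_fun => /tagnat.rank_inj e.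
rewrite -(tagnat.sigK p) -(tagnat.sigK q); congr tagnat.rank; move: e.
rewrite !tagnat.sigE12; move: (tagnat.sig2 p) (tagnat.sig2 q).
move: (tagnat.sig1 p) (tagnat.sig1 q) => i i' j j' e.
have e1 : i = i' := congr1 tag e.
case: _ / e1 in j' e *.
by move/eqP: e; rewrite eq_Tagged => /eqP /perm_inj ->.
Qed.

Definition sum_perm : 'S_(\sum_i m i)%N := perm sum_perm_inj.

End SumPerm.

Section Operads.
Variable k : fieldType.

Record operad_data := OperadData {
  op_sort :> nat -> lmodType k ;
  op_id : op_sort 1 ;
  op_act : forall n, op_sort n -> 'S_n -> op_sort n ;
  op_comp : forall n (m : 'I_n -> nat),
    op_sort n -> (forall i, op_sort (m i)) -> op_sort (\sum_i m i)%N }.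

Definition opcast (P : nat -> lmodType k) a b (e : a = b) (x : P a) : P b :=
  ecast c (P c) e x.

(* Right action convention: theta * (s o t) = (theta * s) * t.  The product of
   MathComp permutations is (t * s) i = s (t i), whence t * s below. *)
Record operad_axioms (P : operad_data) : Prop := OperadAxioms {
  op_act1 : forall n (x : P n), op_act x 1%g = x ;
  op_actM : forall n (x : P n) (s t : 'S_n),
    op_act (op_act x s) t = op_act x (t * s)%g ;
  op_act_linear : forall n (s : 'S_n) (a : k) (x y : P n),
    op_act (a *: x + y) s = a *: op_act x s + op_act y s ;
  op_comp_linearl : forall n (m : 'I_n -> nat) (a : k) (x y : P n)
      (u : forall i, P (m i)),
    op_comp (a *: x + y) u = a *: op_comp x u + op_comp y u ;
  op_comp_linearr : forall n (m : 'I_n -> nat) (x : P n) (i : 'I_n) (a : k)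
      (u v w : forall i, P (m i)),
    (forall j, j != i -> u j = w j /\ v j = w j) ->
    w i = a *: u i + v i ->
    op_comp x w = a *: op_comp x u + op_comp x v ;
  op_unitl : forall n (x : P n),
    opcast (sum_single n) (op_comp (op_id P) (fun _ : 'I_1 => x)) = x ;
  op_unitr : forall n (x : P n),
    opcast (sum_ones n) (op_comp x (fun _ : 'I_n => op_id P)) = x ;
  op_assoc : forall n (m : 'I_n -> nat) (l : 'I_(\sum_i m i)%N -> nat)
      (x : P n) (u : forall i, P (m i)) (v : forall p, P (l p)),
    op_comp (op_comp x u) v =
    opcast (sum_Rank l)
      (op_comp x (fun i => op_comp (u i) (fun j => v (tagnat.Rank i j)))) ;
  op_equivl : forall n (m : 'I_n -> nat) (x : P n) (u : forall i, P (m i))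
      (s : 'S_n),
    op_comp (op_act x s) u =
    op_act (opcast (sum_permV s m) (op_comp x (fun i => u (s^-1%g i))))
           (block_perm s m) ;
  op_equivr : forall n (m : 'I_n -> nat) (x : P n) (u : forall i, P (m i))
      (t : forall i, 'S_(m i)),
    op_comp x (fun i => op_act (u i) (t i)) = op_act (op_comp x u) (sum_perm t)
}.

Record operad := Operad {
  op_struct :> operad_data ;
  op_ax : operad_axioms op_struct }.

Record operad_morphism (P Q : operad) := OperadMorphism {
  om_fun :> forall n, {linear P n -> Q n} ;
  om_id : om_fun 1%N (op_id P) = op_id Q ;
  om_act : forall n (x : P n) (s : 'S_n),
    om_fun n (op_act x s) = op_act (om_fun n x) s ;
  om_comp : forall n (m : 'I_n -> nat) (x : P n) (u : forall i, P (m i)),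
    om_fun _ (op_comp x u) = op_comp (om_fun n x) (fun i => om_fun _ (u i)) }.

Record unitary_operad := UnitaryOperad {
  uo_operad :> operad ;
  one0 : uo_operad 0 ;
  one0_neq0 : one0 != 0 ;
  one0_span : forall x : uo_operad 0, exists c : k, x = c *: one0 }.

Definition one01 (P : unitary_operad) (b : bool) : P b :=
  if b as b' return P b' then op_id P else one0 P.

(* Indices of 'I_2: ord0 is the first input and ord_max the second one. *)
Record two_unitary_operad := TwoUnitaryOperad {
  tuo_unitary :> unitary_operad ;
  one2 : tuo_unitary 2 ;
  one2_one0_id : opcast (sum_delta (ord_max : 'I_2))
    (op_comp one2 (fun i => one01 tuo_unitary (i == ord_max)))
    = op_id tuo_unitary ;
  one2_id_one0 : opcast (sum_delta (ord0 : 'I_2))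
    (op_comp one2 (fun i => one01 tuo_unitary (i == ord0)))
    = op_id tuo_unitary }.

Definition Com_data : operad_data :=
  @OperadData (fun _ => k^o) 1 (fun n x _ => x)
    (fun n m x u => (x : k) * \prod_i (u i : k)).

Lemma opcast_cst (V : lmodType k) a b (e : a = b) (x : V) :
  @opcast (fun _ => V) a b e x = x.
Proof. by case: _ / e. Qed.

Lemma Com_axioms : operad_axioms Com_data.
Proof.
split=> //=.
- move=> n m a x y u; rewrite mulrDl; congr (_ + _).
  exact: esym (mulrA a (x : k) _).
- move=> n m x i a u v w uvw wi.
  rewrite -[RHS]/(a * (x * \prod_j (u j : k)) + x * \prod_j (v j : k) : k).
  rewrite (bigD1 i) //= [X in a * (_ * X)](bigD1 i) //=.
  rewrite [X in _ + _ * X](bigD1 i) //=.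
  have -> : \prod_(j < n | j != i) (u j : k) = \prod_(j < n | j != i) (w j : k).
    by apply: eq_bigr => j /uvw[-> _].
  have -> : \prod_(j < n | j != i) (v j : k) = \prod_(j < n | j != i) (w j : k).
    by apply: eq_bigr => j /uvw[_ ->].
  have distr (b c d e : k) : b * ((a * c + d) * e) = a * (b * (c * e)) + b * (d * e).
    by rewrite mulrDl mulrDr -!mulrA [b * (a * _)]mulrCA.
  rewrite wi; exact: distr.
- by move=> n x; rewrite (@opcast_cst k^o) big_ord1 mul1r.
- by move=> n x; rewrite (@opcast_cst k^o) big1 ?mulr1.
- move=> n m l x u v; rewrite (@opcast_cst k^o) big_split /= -mulrA.
  congr (_ * (_ * _)); rewrite sig_big_dep /= (reindex tagnat.rank) /=.
    by apply: eq_bigr => -[i j] _; rewrite tagnat.rankE.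
  exact/onW_bij/tagnat.rank_bij.
- move=> n m x u s; rewrite (@opcast_cst k^o); congr (_ * _).
  by rewrite (reindex_inj (@perm_inj _ s^-1%g)).
Qed.

Definition Com_operad : operad := Operad Com_axioms.

Lemma Com_one0_span (x : Com_operad 0) :
  exists c : k, x = c *: (1 : k^o).
Proof. by exists x; rewrite -[RHS]/((x : k) * 1) mulr1. Qed.

Definition Com : unitary_operad :=
  @UnitaryOperad Com_operad (1 : k^o) (oner_neq0 k) Com_one0_span.

(* An object of Op_Com: the element 1_0 of P is the image of that of Com. *)
Record op_Com := OpCom {
  oc_operad :> unitary_operad ;
  oc_mor : operad_morphism Com oc_operad ;
  oc_one0 : oc_mor 0%N (one0 Com) = one0 oc_operad }.

Section TwoUnitaryOfOpCom.
Variable P : op_Com.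

Lemma oc_mor_cast a b (e : a = b) (x : Com a) :
  oc_mor P b (opcast e x) = opcast e (oc_mor P a x).
Proof. by case: _ / e. Qed.

Lemma oc_mor_one01 (b : bool) : oc_mor P b (one01 Com b) = one01 P b.
Proof. by case: b => /=; rewrite ?oc_one0 ?om_id. Qed.

Lemma oc_one2 (i0 : 'I_2) : opcast (sum_delta i0)
  (op_comp (oc_mor P 2 (1 : k^o)) (fun i => one01 P (i == i0))) = op_id P.
Proof.
have -> : (fun i => one01 P (i == i0)) =
    (fun i => oc_mor P _ (one01 Com (i == i0))).
  by apply: functional_extensionality_dep => i; rewrite oc_mor_one01.
rewrite -om_comp -oc_mor_cast -[RHS](om_id (oc_mor P)); congr (oc_mor P _ _).
rewrite (@opcast_cst k^o) /= mul1r big1 // => i _.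
by case: (i == i0).
Qed.

Definition op_Com_two_unitary : two_unitary_operad :=
  TwoUnitaryOperad (oc_one2 ord_max) (oc_one2 ord0).

End TwoUnitaryOfOpCom.

Definition truncation (P : unitary_operad) n (I : {set 'I_n}) (x : P n) :
    P #|I| :=
  opcast (sum_mem I) (op_comp x (fun i => one01 P (i \in I))).

Local Open Scope classical_set_scope.

(* Only meaningful for l >= 1. *)
Definition Upsilon (P : unitary_operad) (l n : nat) : set (P n) :=
  if (l <= n)%N
  then [set x | forall I : {set 'I_n}, #|I| = l.-1 -> truncation I x = 0]
  else [set 0].

(* The subspace W of V has a basis of m elements. *)
Definition has_dim (V : lmodType k) (W : set V) (m : nat) : Prop :=
  exists e : 'I_m -> V,
    [/\ forall i, W (e i),
        forall c : 'I_m -> k, \sum_i c i *: e i = 0 -> forall i, c i = 0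
      & forall x, W x -> exists c : 'I_m -> k, x = \sum_i c i *: e i].

(* S(P) = (d 1, d 2, d 3, ...); the value d 0 is irrelevant. *)
Definition has_signature (P : unitary_operad) (d : nat -> nat) : Prop :=
  forall l, (0 < l)%N -> has_dim (@Upsilon P l l) (d l).

Definition locally_finite (P : operad) : Prop :=
  forall n, exists m, has_dim [set: P n] m.

Definition op_dim (P : operad) (n : nat) : nat :=
  xget 0%N [set m | has_dim [set: P n] m].

(* The term n = 0, where 0^-1 = 0, does not affect the limit superior. *)
Definition exponent (R : realType) (P : operad) : \bar R :=
  limn_esup (fun n => ((op_dim P n)%:R `^ (n%:R^-1))%:E).

End Operads.

Local Open Scope classical_set_scope.

Definition exponent_values (R : realType) : set (\bar R) :=
  [set x : \bar R | x = 1%E \/ (2%:E <= x)%E].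
Arguments exponent_values R : clear implicits.

(* Main.v *)
Require Import Defs.
From HB Require Import structures.
From mathcomp Require Import all_boot all_order all_fingroup all_algebra.
From mathcomp Require Import all_classical all_reals all_analysis.
From mathcomp Require Import ring lra zify.

Set Implicit Arguments.
Unset Strict Implicit.
Unset Printing Implicit Defensive.

Import Order.TTheory GRing.Theory Num.Theory.
Local Open Scope ring_scope.
Import boot.fintype boot.finset.

(** Dimensions are controlled by truncations, the replacement by 1_0 of the
    inputs outside a set of positions.  Truncations to nested sets compose, and
    in a 2-unitary operad they have one-sided inverses: an element y of arity j
    is padded to arity j + m by multiplying it with an element that becomes 1_0
    when all its inputs are replaced by 1_0.

    Dichotomy.  If the spaces Upsilon^j(j) vanish for all j > K, then for
    n >= K the truncations to the K-element subsets are jointly injective on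
    P(n) ([restr_jointly_injective]), so dim P(n) <= C(n, K) dim P(K) grows
    polynomially and the exponent is 1.  Otherwise there are arbitrarily large
    j with a nonzero y in Upsilon^j(j).  Since every proper truncation of y
    vanishes, the C(2j, j) translates of the padding of y to arity 2j are
    separated by the truncations to the j-element subsets, hence independent
    ([binomial_le_op_dim]); as C(2j, j) >= 4^j / (2j + 1), the exponent
    is at least 2.

    Existence.  Call presheaf a contravariant functor A from the ordinals
    [n], with partial maps, to commutative algebras.  It carries a canonical
    operad structure under Com: the composite of x with (u_1, ..., u_n) is the
    product in A of the pullback of x along the map sending a position to its
    block and of the pullbacks of the u_i along the partial maps that are only
    defined on the i-th block.  The operad axioms then follow from identities
    between partial maps ([presheaf_axioms]).  For a sequence d take for A([n])
    the functions on the pairs (J, a), where J is a subset of [n] and a is less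
    than d_|J| (less than 1 when J is empty), with the square-zero product on
    the part supported on nonempty J; a partial map pulls functions back through
    the image of J, with value 0 unless it is defined and injective on J.  Informally the generators act as symmetric multiderivations all of
    whose iterated composites vanish.  The truncation to I only retains the
    coefficients at the subsets of I, hence the signature is d, and
    dim P(n) = 1 + sum_(j >= 1) C(n, j) d_j.  The integer part of (x - 1)^j
    for d_j gives exponent x whenever x = 1 or 2 <= x < oo
    ([growth_rate_eq]), and d_j = j^j gives an infinite exponent. *)

(** * Dimensions of subspaces *)

Section Dimension.
Variable k : fieldType.
Local Open Scope classical_set_scope.

Lemma indep_le_dim (V : lmodType k) (W : set V) m N (v : 'I_N -> V) :
  has_dim W m -> (forall i, W (v i)) ->
  (forall c : 'I_N -> k, \sum_i c i *: v i = 0 -> forall i, c i = 0) ->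
  (N <= m)%N.
Proof.
move=> [e [_ _ gen]] Wv indep.
pose M := \matrix_(i < N, j < m) projT1 (cid (gen _ (Wv i))) j.
have ME i : v i = \sum_j M i j *: e j.
  rewrite {1}(projT2 (cid (gen _ (Wv i)))).
  by apply: eq_bigr => j _; rewrite mxE.
suff /eqP <- : row_free M by exact: rank_leq_col.
apply: inj_row_free => c cM; apply/rowP => i; rewrite [RHS]mxE.
apply: (indep (c 0)) => {i}; under eq_bigr do rewrite ME scaler_sumr.
rewrite exchange_big /= big1 // => j _.
under eq_bigr do rewrite scalerA.
rewrite -scaler_suml; move/rowP/(_ j): cM; rewrite !mxE => ->.
by rewrite scale0r.
Qed.

Lemma has_dim_uniq (V : lmodType k) (W : set V) m m' :
  has_dim W m -> has_dim W m' -> m = m'.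
Proof.
move=> Wm Wm'; apply/eqP; rewrite eqn_leq; apply/andP; split.
- by have [e [We indep _]] := Wm; exact: indep_le_dim Wm' We indep.
- by have [e [We indep _]] := Wm'; exact: indep_le_dim Wm We indep.
Qed.

(** A vector of coefficients killed by the matrix of the coordinates of all the
    f t (e i) gives a combination of the e i killed by every f t. *)
Lemma dim_le_jointly_injective (V : lmodType k) m (T : finType) q
    (W : T -> lmodType k) (f : forall t, {linear V -> W t}) :
  has_dim [set: V] m -> (forall t, has_dim [set: W t] q) ->
  (forall x, (forall t, f t x = 0) -> x = 0) -> (m <= #|T| * q)%N.
Proof.
move=> [e [_ indep _]] Wq finj.
pose b t := projT1 (cid (Wq t)).
have gen t (x : W t) : exists c : 'I_q -> k, x = \sum_i c i *: b t i.
  by have [_ _ /(_ x)] := projT2 (cid (Wq t)); apply.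
pose coord i (z : T * 'I_q) := projT1 (cid (gen z.1 (f z.1 (e i)))) z.2.
pose M := \matrix_(i < m, z < #|{: T * 'I_q}|) coord i (enum_val z).
suff /eqP <- : row_free M.
  by apply: leq_trans (rank_leq_col _) _; rewrite card_prod card_ord.
apply: inj_row_free => c cM; apply/rowP => i; rewrite [RHS]mxE.
apply: (indep (c 0)) => {i}; apply: finj => t.
rewrite linear_sum /=.
have fE i : f t (c 0 i *: e i) = \sum_j (c 0 i * coord i (t, j)) *: b t j.
  rewrite linearZ /= {1}(projT2 (cid (gen t (f t (e i))))) scaler_sumr.
  by apply: eq_bigr => j _; rewrite scalerA.
under eq_bigr do rewrite fE.
rewrite exchange_big /= big1 // => j _; rewrite -scaler_suml.
move/rowP/(_ (enum_rank (t, j))): cM; rewrite !mxE => cM.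
suff -> : \sum_i c 0 i * coord i (t, j) = 0 by rewrite scale0r.
by rewrite -[RHS]cM; apply: eq_bigr => i _; rewrite mxE enum_rankK.
Qed.

Lemma has_dim_support (T : finType) (S : {set T}) :
  has_dim [set f : {ffun T -> k^o} | forall t, t \notin S -> f t = 0] #|S|.
Proof.
exists (fun i => [ffun t => (t == enum_val i)%:R]); split.
- move=> i t /= tS; rewrite ffunE; case: eqP => // et.
  by rewrite et enum_valP in tS.
- move=> c /ffunP c0 i; move: (c0 (enum_val i)).
  rewrite sum_ffunE ffunE (bigD1 i) //= big1 => [|j ji].
    by rewrite !ffunE eqxx addr0 /GRing.scale /= mulr1.
  rewrite !ffunE (inj_eq enum_val_inj) eq_sym (negbTE ji).
  by rewrite /GRing.scale /= mulr0.
- move=> f fS; exists (fun i => f (enum_val i)); apply/ffunP => t.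
  rewrite sum_ffunE; have [tS|tS] := boolP (t \in S); last first.
    rewrite fS // big1 // => i _; rewrite !ffunE.
    case: eqP => [et|_]; first by rewrite et enum_valP in tS.
    by rewrite /GRing.scale /= mulr0.
  rewrite (bigD1 (enum_rank_in tS t)) //= big1 => [|j ji].
    by rewrite !ffunE enum_rankK_in // eqxx addr0 /GRing.scale /= mulr1.
  rewrite !ffunE; case: eqP => [et|_]; last by rewrite /GRing.scale /= mulr0.
  by case/eqP: ji; apply: enum_val_inj; rewrite enum_rankK_in.
Qed.

Lemma op_dimE (P : operad k) n m : has_dim [set: P n] m -> op_dim P n = m.
Proof.
move=> Pm; rewrite /op_dim; case: xgetP => [m' _ Pm'|/(_ m)//].
exact: has_dim_uniq Pm' Pm.
Qed.

Lemma op_dimP (P : operad k) n :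
  locally_finite P -> has_dim [set: P n] (op_dim P n).
Proof. by move=> /(_ n)[m Pm]; rewrite (op_dimE Pm). Qed.

End Dimension.

(** * Exponential growth rates *)

Section RootTest.
Variable R : realType.
Local Open Scope classical_set_scope.
Implicit Types (u : nat -> nat) (x : R).

Definition growth_rate u : \bar R :=
  limn_esup (fun n => ((u n)%:R `^ (n%:R^-1))%:E).

Lemma root_exp n x : (0 < n)%N -> 0 <= x -> (x ^+ n) `^ (n%:R^-1) = x.
Proof.
move=> n0 x0; rewrite -powR_mulrn // -powRrM mulfV ?powRr1 //.
by rewrite pnatr_eq0 -lt0n.
Qed.

Lemma root_le u n x : (0 < n)%N -> 0 <= x -> (u n)%:R <= x ^+ n ->
  (u n)%:R `^ (n%:R^-1) <= x.
Proof.
move=> n0 x0 ux; rewrite -[leRHS](root_exp n0 x0).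
by apply: ge0_ler_powR; rewrite ?invr_ge0 // nnegrE // exprn_ge0.
Qed.

Lemma root_ge u n x : (0 < n)%N -> 0 <= x -> x ^+ n <= (u n)%:R ->
  x <= (u n)%:R `^ (n%:R^-1).
Proof.
move=> n0 x0 ux; rewrite -[leLHS](root_exp n0 x0).
by apply: ge0_ler_powR; rewrite ?invr_ge0 // nnegrE // exprn_ge0.
Qed.

(** The n-th root is only compared for n > 0, which is harmless in a limit
    superior. *)
Lemma growth_rate_le u x : 0 <= x ->
  (forall h, 0 < h -> exists n0, forall n, (n0 <= n)%N ->
    (u n)%:R <= (x + h) ^+ n) ->
  (growth_rate u <= x%:E)%E.
Proof.
move=> x0 ux; apply/lee_addgt0Pr => h h0; have [n0 un0] := ux h h0.
apply: ge_ereal_inf; eexists.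
  by exists [set n | (maxn 1 n0 <= n)%N]; [exists (maxn 1 n0) | reflexivity].
apply: ge_ereal_sup => z [n /=]; rewrite geq_max => /andP[n1 n0n] <-.
rewrite -EFinD lee_fin; apply: root_le => //; last exact: un0.
by rewrite addr_ge0 // ltW.
Qed.

Lemma growth_rate_ge u x :
  (forall y, 0 <= y < x -> forall n0, exists2 n, (n0 <= n)%N &
    y ^+ n <= (u n)%:R) ->
  (x%:E <= growth_rate u)%E.
Proof.
move=> ux; apply: le_ereal_inf_tmp => _ [V [n0 _ n0V] <-].
have sup_ge y : 0 <= y < x ->
    (y%:E <= ereal_sup [set ((u n)%:R `^ (n%:R^-1))%:E | n in V])%E.
  move=> yx; have [n n1 yn] := ux y yx (maxn 1 n0).
  move: n1; rewrite geq_max => /andP[n1 n0n].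
  apply: le_trans (ereal_sup_ubound _); last first.
    by exists n; [exact: n0V | reflexivity].
  by rewrite lee_fin; apply: root_ge => //; case/andP: yx.
have [x0|x0] := ltP 0 x; last first.
  apply: le_trans (ereal_sup_ubound _); last first.
    by exists n0; [apply: n0V => /= | reflexivity].
  by rewrite lee_fin (le_trans x0) // powR_ge0.
apply/lee_subgt0Pr => h h0; rewrite -EFinB.
have [hx|hx] := leP h x.
  by apply: sup_ge; rewrite subr_ge0 hx gtrBl.
by apply: le_trans (sup_ge 0 _); rewrite ?lexx // lee_fin subr_le0 ltW.
Qed.

End RootTest.

Section BinomialGrowth.
Variable R : realType.

Lemma binomial_le_exp (h : R) (n j : nat) : 0 < h ->
  'C(n, j)%:R * h ^+ j <= (1 + h) ^+ n.
Proof.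
move=> h0; rewrite addrC exprDn; have [jn|nj] := leqP j n; last first.
  by rewrite bin_small // mul0r sumr_ge0 // => i _;
     rewrite mulrn_wge0 // mulr_ge0 // exprn_ge0 // ltW.
have lt : (n - j < n.+1)%N by rewrite ltnS leq_subr.
rewrite (bigD1 (Ordinal lt)) //= subKn // expr1n mulr1 bin_sub //.
rewrite mulr_natl lerDl sumr_ge0 // => i _.
by rewrite mulrn_wge0 // mulr_ge0 // exprn_ge0 // ltW.
Qed.

(** The next binomial coefficient C(n, j + 1) is at most a constant times
    (1 + h)^n, and it exceeds C(n, j) by the unbounded factor
    (n - j) / (j + 1). *)
Lemma binomial_eventually_le_exp (h : R) (j q : nat) : 0 < h ->
  exists n0, forall n, (n0 <= n)%N -> ('C(n, j) * q)%:R <= (1 + h) ^+ n.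
Proof.
move=> h0.
have hj : 0 < h ^+ j.+1 by rewrite exprn_gt0.
(* For n - j > b the factor (n - j) / (j + 1) * h^(j + 1) exceeds q. *)
pose b := Num.Def.truncn (q%:R * j.+1%:R / h ^+ j.+1 : R).
exists (j + b.+1)%N => n lenn.
apply: le_trans (binomial_le_exp n j.+1 h0).
have nj : (j <= n)%N by apply: leq_trans lenn; rewrite leq_addr.
rewrite -(ler_pM2r (_ : 0 < j.+1%:R :> R)) // mulrAC -[X in _ <= X * _]natrM.
rewrite [('C(n, j.+1) * _)%N]mulnC mul_bin_left.
rewrite [in leRHS]mulnC !natrM -!mulrA ler_wpM2l //.
rewrite -ler_pdivrMr //; apply: ltW.
by apply: lt_le_trans (truncnS_gt _) _; rewrite ler_nat ltn_subRL -addnS.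
Qed.

End BinomialGrowth.

(** * Positions in nested blocks *)

Section Blocks.
Variables (n : nat) (m : 'I_n -> nat).

(** The partial inverse of the inclusion of the i-th block. *)
Definition unrank (i : 'I_n) (p : 'I_(\sum_i m i)%N) : option 'I_(m i) :=
  [pick j | tagnat.Rank i j == p].

Lemma unrankK i j : unrank i (tagnat.Rank i j) = Some j.
Proof.
rewrite /unrank; case: pickP => [j' /eqP /(congr1 val)/eqP | /(_ j)].
  by rewrite /= tagnat.eq_Rank => /andP[_ /eqP e]; congr Some; apply: val_inj.
by rewrite eqxx.
Qed.

Lemma unrankN i i' j : i != i' -> unrank i (tagnat.Rank i' j) = None.
Proof.
move=> ne; rewrite /unrank; case: pickP => // j' /eqP /(congr1 val)/eqP.
by rewrite /= tagnat.eq_Rank (negbTE ne).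
Qed.

Lemma rank_ind (T : 'I_(\sum_i m i)%N -> Prop) :
  (forall i j, T (tagnat.Rank i j)) -> forall p, T p.
Proof. by move=> TR p; rewrite -(tagnat.sig2K p). Qed.

Lemma prod_Rank (R : comNzRingType) (F : 'I_(\sum_i m i)%N -> R) :
  \prod_p F p = \prod_i \prod_j F (tagnat.Rank i j).
Proof.
rewrite sig_big_dep /= (reindex tagnat.rank) /=; last first.
  exact/onW_bij/tagnat.rank_bij.
by apply: eq_bigr => -[i j] _; rewrite tagnat.rankE.
Qed.

Lemma lt_RankE i i' (j : 'I_(m i)) (j' : 'I_(m i')) :
  (tagnat.Rank i' j' < tagnat.Rank i j)%N
  = ((i' < i) || (i' == i) && (j' < j))%N.
Proof.
rewrite -[LHS]/(tagnat.rank (Tagged _ j') < tagnat.rank (Tagged _ j))%O.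
rewrite tagnat.lt_rank ltEsig /= !leEord.
case: (ltngtP i' i) => [//|gt|/val_inj e] /=.
  by rewrite -val_eqE /= (gtn_eqF gt).
by case: _ / e in j *; rewrite eqxx tagged_asE.
Qed.

End Blocks.

Lemma sig1_mem n (I : {set 'I_n}) (p : 'I_(\sum_i (i \in I))%N) :
  tagnat.sig1 p \in I.
Proof.
elim/rank_ind: p => i j; rewrite tagnat.Rank1K.
by move: j; case: (i \in I) => //; case.
Qed.

Lemma sig1_mem_inj n (I : {set 'I_n}) :
  injective (@tagnat.sig1 n (fun i => i \in I : nat)).
Proof.
move=> p q; elim/rank_ind: p => i j; elim/rank_ind: q => i' j'.
rewrite !tagnat.Rank1K => e; subst i'; congr (tagnat.Rank i _).
by move: j j'; case: (i \in I) => j j'; [rewrite !ord1 | case: j].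
Qed.

Section NestedBlocks.
Variables (n : nat) (m : 'I_n -> nat) (l : 'I_(\sum_i m i)%N -> nat).

(** The two ways of flattening a doubly nested family of blocks list the
    positions in the same order: both count the positions that precede
    (i, j, r) lexicographically. *)
Lemma Rank_assoc i (j : 'I_(m i)) (r : 'I_(l (tagnat.Rank i j))) :
  cast_ord (sum_Rank l)
    (@tagnat.Rank n (fun i => \sum_(j < m i) l (tagnat.Rank i j))%N i
       (@tagnat.Rank (m i) (fun j => l (tagnat.Rank i j)) j r))
  = tagnat.Rank (tagnat.Rank i j) r.
Proof.
pose before i' (j' : 'I_(m i')) := ((i' < i) || (i' == i) && (j' < j))%N.
apply: ord_inj; rewrite [LHS]tagnat.RankEsum.
rewrite [X in (_ + X)%N = _]tagnat.RankEsum [RHS]tagnat.RankEsum addnA.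
congr (_ + _)%N.
transitivity (\sum_(i' < n) \sum_(j' < m i' | before i' j')
    l (tagnat.Rank i' j'))%N; last first.
  rewrite sig_big_dep /= [RHS](reindex tagnat.rank) /=; last first.
    exact/onW_bij/tagnat.rank_bij.
  apply: eq_big => -[i' j'] /=; first exact/esym/lt_RankE.
  by rewrite tagnat.rankE.
rewrite [RHS](bigID (fun i' : 'I_n => i' < i)%N) /=.
congr (_ + _)%N.
  by apply: eq_bigr => i' lt; apply: eq_bigl => j'; rewrite /before lt.
rewrite (bigD1 i) ?ltnn //= [X in (_ + X)%N]big1 ?addn0.
  by apply: eq_bigl => j'; rewrite /before ltnn eqxx.
move=> i' /andP[/negbTE lt /negbTE ne].
by rewrite big_pred0 // => j'; rewrite /before lt ne.
Qed.

(** Inverting the inclusion of a subblock can be done in two steps. *)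
Lemma unrank_Rank i (j : 'I_(m i)) q :
  unrank (tagnat.Rank i j) q =
  obind (unrank j) (unrank i (cast_ord (esym (sum_Rank l)) q)).
Proof.
elim/rank_ind: q => p; elim/rank_ind: p => i' j' r.
rewrite -Rank_assoc cast_ordK Rank_assoc.
have [e|ne] := eqVneq i i'; last first.
  rewrite [X in obind _ X]unrankN //= unrankN //; apply: contra ne.
  by move/eqP/(congr1 val)/eqP; rewrite /= tagnat.eq_Rank => /andP[].
subst i'; rewrite [X in obind _ X]unrankK /=.
have [e|ne] := eqVneq j j'; last first.
  rewrite [RHS]unrankN // unrankN //; apply: contra ne.
  move/eqP/(congr1 val)/eqP; rewrite /= tagnat.eq_Rank => /andP[_ /eqP e].
  exact/eqP/val_inj.
by subst j'; rewrite !unrankK.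
Qed.

End NestedBlocks.

(** * Operad identities up to transport of the arity *)

Section SameUpToArity.
Variables (k : fieldType) (P : operad k).

(** Equality of two operations whose arities are only provably equal, as happens
    for the two sides of the associativity and unit laws; it composes without
    any computation with casts. *)
Definition same a (x : P a) b (y : P b) : Prop :=
  existT (fun n => P n : Type) a x = existT (fun n => P n : Type) b y.

Lemma same_sym a (x : P a) b (y : P b) : same x y -> same y x.
Proof. exact: esym. Qed.

Lemma same_trans a (x : P a) b (y : P b) c (z : P c) :
  same x y -> same y z -> same x z.
Proof. exact: etrans. Qed.

Lemma same_eq a (x y : P a) : same x y -> x = y.
Proof. by move=> /eqP; rewrite eq_Tagged => /eqP. Qed.

Lemma same_opcast a b (e : a = b) (x : P a) : same (opcast e x) x.
Proof. by case: b / e. Qed.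

Lemma same_eq0 a (x : P a) b (y : P b) : same x y -> x = 0 -> y = 0.
Proof.
move=> xy x0; pose zero (t : {n & P n : Type}) := tagged t = 0 :> P (tag t).
by have : zero (existT _ a x) by []; rewrite xy.
Qed.

Lemma same_comp n (m m' : 'I_n -> nat) (x : P n) (u : forall i, P (m i))
    (u' : forall i, P (m' i)) :
  (forall i, same (u i) (u' i)) -> same (op_comp x u) (op_comp x u').
Proof.
move=> uu'; have e : m = m'.
  by apply/funext => i; move: (uu' i) => /(congr1 (@projT1 _ _)).
subst m'; suff -> : u = u' by [].
by apply: functional_extensionality_dep => i; apply: same_eq.
Qed.

Lemma same_comp_cst a b (x : P a) (x' : P b) c (y : P c) : same x x' ->
  same (op_comp x (fun _ => y)) (op_comp x' (fun _ => y)).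
Proof.
pose C (t : {n & P n : Type}) : {n & P n : Type} :=
  existT (fun n => P n : Type) _ (op_comp (tagged t : P (tag t)) (fun _ => y)).
by move=> /(congr1 C).
Qed.

Lemma same_assoc n (m : 'I_n -> nat) (l : 'I_(\sum_i m i)%N -> nat)
    (x : P n) (u : forall i, P (m i)) (v : forall p, P (l p)) :
  same (op_comp (op_comp x u) v)
       (op_comp x (fun i => op_comp (u i) (fun j => v (tagnat.Rank i j)))).
Proof. by rewrite (op_assoc (op_ax P)); exact: same_opcast. Qed.

Lemma same_unitl n (x : P n) :
  same (op_comp (op_id P) (fun _ => x)) x.
Proof.
by rewrite -[X in same _ X](op_unitl (op_ax P)); exact/same_sym/same_opcast.
Qed.

Lemma same_unitr n (x : P n) :
  same (op_comp x (fun _ => op_id P)) x.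
Proof.
by rewrite -[X in same _ X](op_unitr (op_ax P)); exact/same_sym/same_opcast.
Qed.

Lemma op_comp0r n (m : 'I_n -> nat) (x : P n) (u : forall i, P (m i)) i :
  u i = 0 -> op_comp x u = 0.
Proof.
move=> ui; have := op_comp_linearr (op_ax P) (m := m) x (i := i) (a := 1)
  (u := u) (v := u) (w := u).
rewrite ui scale1r addr0 scale1r => /(_ (fun _ _ => conj erefl erefl) erefl).
by move/eqP; rewrite -subr_eq subrr => /eqP <-.
Qed.

Lemma op_comp0l n (m : 'I_n -> nat) (u : forall i, P (m i)) :
  op_comp (0 : P n) u = 0.
Proof.
have := op_comp_linearl (op_ax P) 1 0 (0 : P n) u.
by rewrite scale1r addr0 scale1r => /eqP; rewrite -subr_eq subrr => /eqP <-.
Qed.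

Lemma op_act0 n (s : 'S_n) : op_act (0 : P n) s = 0.
Proof.
have := op_act_linear (op_ax P) s 1 0 (0 : P n).
by rewrite scale1r addr0 scale1r => /eqP; rewrite -subr_eq subrr => /eqP <-.
Qed.

Lemma op_act_eq0 n (x : P n) (s : 'S_n) : op_act x s = 0 -> x = 0.
Proof.
move=> xs0; rewrite -(op_act1 (op_ax P) x) -(mulVg s) -(op_actM (op_ax P)) xs0.
exact: op_act0.
Qed.

End SameUpToArity.

(** * Truncations and the polynomial upper bound *)

Section Restriction.
Variables (k : fieldType) (P : unitary_operad k).

Definition restr n (I : {set 'I_n}) (x : P n) : P (\sum_i (i \in I))%N :=
  op_comp x (fun i => one01 P (i \in I)).

Lemma restr_is_linear n (I : {set 'I_n}) : linear (@restr n I).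
Proof. by move=> c x y; rewrite /restr (op_comp_linearl (op_ax P)). Qed.

HB.instance Definition _ n (I : {set 'I_n}) :=
  GRing.isLinear.Build k (P n) (P (\sum_i (i \in I))%N) _ (@restr n I)
    (@restr_is_linear n I).

(** Truncations of an argument inside a composite arise as predicates on its
    positions, pulled back from those of the composite. *)
Definition prestr n (f : pred 'I_n) (x : P n) : P (\sum_i f i)%N :=
  op_comp x (fun i => one01 P (f i)).

Lemma truncation_eq0 n (I : {set 'I_n}) (x : P n) :
  truncation I x = 0 <-> restr I x = 0.
Proof.
rewrite /truncation -/(restr I x).
by split; apply: same_eq0; [|apply: same_sym]; exact: same_opcast.
Qed.

(** Both cases are unit laws; when b is false, the family y has no member, so
    the composite is the right unit law for 1_0. *)
Lemma same_comp_one01 (b : bool) c (y : P c) :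
  same (op_comp (one01 P b) (fun _ : 'I_b => y))
       (if b as b return P (if b then c else 0%N) then y else one0 P).
Proof.
case: b => /=; first exact: same_unitl.
apply: same_trans (same_unitr (one0 P)).
by apply: same_comp => -[].
Qed.

(** The inputs of x outside J are already replaced by 1_0; the remaining ones
    are filled with 1 or 1_0 according to I. *)
Lemma restr_sub n (I J : {set 'I_n}) (x : P n) : I \subset J ->
  same (op_comp (restr J x) (fun p => one01 P (tagnat.sig1 p \in I)))
       (restr I x).
Proof.
move=> /subsetP sIJ; apply: same_trans (same_assoc _ _ _) _.
apply: same_comp => i.
apply: (@same_trans _ _ _ _ _
    (op_comp (one01 P (i \in J)) (fun _ => one01 P (i \in I)))).
  by apply: same_comp => j; rewrite tagnat.Rank1K.
apply: same_trans (same_comp_one01 _ _) _.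
have := sIJ i; case: (i \in J) => //; case: (i \in I) => // H.
by have := H isT.
Qed.

Lemma restr_sub_eq0 n (I J : {set 'I_n}) (x : P n) : I \subset J ->
  restr J x = 0 -> restr I x = 0.
Proof.
move=> sIJ x0; apply: same_eq0 (restr_sub x sIJ) _; by rewrite x0 op_comp0l.
Qed.

(** The positions that survive in [restr J x] are the elements of J, so that a
    subset of them is the same as a subset of J. *)
Lemma restr_restr n (J : {set 'I_n}) (I : {set 'I_(\sum_i (i \in J))%N})
    (x : P n) :
  same (restr I (restr J x)) (restr (@tagnat.sig1 n _ @: I) x).
Proof.
apply: same_trans (restr_sub x _); last first.
  by apply/subsetP => _ /imsetP[p _ ->]; exact: sig1_mem.
by apply: same_comp => p; rewrite mem_imset; last exact: sig1_mem_inj.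
Qed.

Lemma same_restrT n (x : P n) : same (restr [set: 'I_n]%SET x) x.
Proof.
apply: same_trans (same_unitr x); apply: same_comp => i.
by rewrite in_setT.
Qed.

(** By equivariance, permuting the inputs of x by s transports a truncation to J
    to the truncation to the image of J under s, up to a permutation of the
    result. *)
Lemma restr_act_eq0 n (J : {set 'I_n}) (x : P n) (s : 'S_n) :
  restr J (op_act x s) = 0 <-> prestr (mem (s @: J)) x = 0.
Proof.
rewrite /restr (op_equivl (op_ax P)).
have E : same (opcast (sum_permV s (fun i => i \in J : nat))
    (op_comp x (fun i => one01 P (s^-1%g i \in J)))) (prestr (mem (s @: J)) x).
  apply: same_trans (same_opcast _ _) _; apply: same_comp => i /=.
  have -> // : (i \in s @: J) = (s^-1%g i \in J).
  by rewrite -{1}(permKV s i) mem_imset //; exact: perm_inj.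
split=> [/op_act_eq0|]; first exact: same_eq0.
by move=> /(same_eq0 (same_sym E)) ->; exact: op_act0.
Qed.

Definition Upsilon_trivial_from K := forall j, (K <= j)%N ->
  forall y : P j, (@Upsilon k P j j) y -> y = 0.

(** By induction on the cardinal of J, the truncation of x to J vanishes: its
    own truncations to one input less are truncations of x to smaller sets,
    hence vanish, so that it belongs to a trivial Upsilon^j(j).  The case where
    J is the whole set is the claim. *)
Lemma restr_jointly_injective K n (x : P n) :
  Upsilon_trivial_from K.+1 -> (K <= n)%N ->
  (forall I : {set 'I_n}, #|I| = K -> restr I x = 0) -> x = 0.
Proof.
move=> Utriv Kn x0.
suff restr0 (J : {set 'I_n}) : (K <= #|J|)%N -> restr J x = 0.
  by apply: same_eq0 (same_restrT x) _; apply: restr0; rewrite cardsT card_ord.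
move: {2}#|J| (leqnn #|J|) => N; elim: N J => [|N IH] J JN KJ.
  by apply: x0; apply/eqP; rewrite eqn_leq KJ andbT (leq_trans JN).
have [KJ1|] := ltnP K #|J|; last first.
  by move=> JK; apply: x0; apply/eqP; rewrite eqn_leq JK KJ.
apply: Utriv; rewrite ?sum_mem // /Upsilon leqnn /= => I cI.
have {}cI : #|I| = #|J|.-1 by rewrite cI sum_mem.
apply/truncation_eq0; apply: same_eq0 (same_sym (restr_restr I x)) _.
have cI' : #|@tagnat.sig1 n _ @: I| = #|J|.-1.
  by rewrite card_imset //; exact: sig1_mem_inj.
by apply: IH; rewrite cI'; lia.
Qed.

Lemma op_dim_le_binomial K n : locally_finite P ->
  Upsilon_trivial_from K.+1 -> (K <= n)%N ->
  (op_dim P n <= 'C(n, K) * op_dim P K)%N.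
Proof.
move=> Pfin Utriv Kn.
pose T : finType := {I : {set 'I_n} | #|I| == K}.
have cT : #|T| = 'C(n, K).
  rewrite card_sig -[n in RHS]card_ord -card_draws cardsE.
  by apply: eq_card => I; rewrite !inE.
rewrite -cT.
apply: (@dim_le_jointly_injective _ _ _ T _ _
  (fun I : T => (@restr n (val I) : {linear P n -> _})) (op_dimP n Pfin)).
  by move=> [I /= /eqP cI]; rewrite sum_mem cI; exact: op_dimP.
move=> x xI; apply: restr_jointly_injective Utriv Kn _ => I /eqP cI.
exact: xI (exist _ I cI).
Qed.

End Restriction.

(** * Padding and the binomial lower bound *)

Lemma ord2_ind (T : 'I_2 -> Prop) : T ord0 -> T ord_max -> forall i, T i.
Proof.
move=> T0 T1 [[|[|//]] lt].
  by rewrite (_ : Ordinal lt = ord0) //; exact: val_inj.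
by rewrite (_ : Ordinal lt = ord_max) //; exact: val_inj.
Qed.

(** A transposition exchanging a point of A outside B with a point of B outside
    A brings A closer to B. *)
Lemma exists_perm_imset (T : finType) (A B : {set T}) : #|A| = #|B| ->
  exists s : {perm T}, s @: A = B.
Proof.
move: {2}#|A :\: B| (erefl #|A :\: B|) => N; elim: N A => [|N IH] A cAB cA.
  exists 1%g; have -> : A = B.
    apply/eqP; rewrite eqEcard cA leqnn andbT -setD_eq0.
    exact/eqP/cards0_eq.
  by rewrite (eq_imset (g := id)) ?imset_id // => x; rewrite perm1.
have [a aAB] : exists a, a \in A :\: B by apply/card_gt0P; rewrite cAB.
have [b bBA] : exists b, b \in B :\: A.
  apply/card_gt0P; rewrite -(ltn_add2l #|B :&: A|) cardsID addn0 -cA setIC.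
  by rewrite -(cardsID B A) cAB; lia.
move: aAB bBA; rewrite !inE => /andP[aB aA] /andP[bA bB].
have memt x : (x \in tperm a b @: A) = (tperm a b x \in A).
  by rewrite -{1}(tpermK a b x) mem_imset //; exact: perm_inj.
have [||s sB] := IH (tperm a b @: A).
- apply/eqP; rewrite -eqSS -cAB [in X in _ == X](cardsD1 a) !inE aA aB.
  rewrite add1n eqSS.
  apply/eqP; congr #|pred_of_set _|; apply/setP => x; rewrite !inE.
  rewrite memt.
  case: tpermP => [->|->|/eqP xa _]; last by rewrite xa.
    by rewrite (negbTE bA) eqxx andbF.
  by rewrite bB !andbF.
- by rewrite card_imset //; exact: perm_inj.
exists (tperm a b * s)%g; rewrite -sB -imset_comp; apply: eq_imset => x.
by rewrite permM.
Qed.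

Section Multiplication.
Variables (k : fieldType) (P : two_unitary_operad k).

Definition pair_arity (a b : nat) (i : 'I_2) : nat :=
  if i == ord0 then a else b.

Definition pair_of a b (y : P a) (z : P b) (i : 'I_2) : P (pair_arity a b i) :=
  if i == ord0 as c return P (if c then a else b) then y else z.

Lemma sum_pair_arity a b : (\sum_i pair_arity a b i = a + b)%N.
Proof. by rewrite !big_ord_recl big_ord0 addn0. Qed.

(** The unit law of 1_2 is assumed for the identity only; composing with y on
    the right extends it to all operations. *)
Lemma same_one2_one0 a (y : P a) :
  same (op_comp (one2 P) (pair_of y (one0 P))) y.
Proof.
pose v := op_comp (one2 P) (fun i => one01 P (i == ord0)).
have vid : same v (op_id P).
  rewrite -(one2_id_one0 P); exact/same_sym/same_opcast.
apply: same_trans _ (same_trans (same_comp_cst y vid) (same_unitl y)).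
apply: same_sym; apply: same_trans (same_assoc _ _ _) _.
by apply: same_comp => i; exact: same_comp_one01.
Qed.

Lemma restr_pair_eq0 a b (y : P a) (z : P b)
    (f : pred 'I_(\sum_i pair_arity a b i)%N) :
  prestr (fun j => f (tagnat.Rank (ord0 : 'I_2) j)) y = 0 ->
  prestr f (op_comp (one2 P) (pair_of y z)) = 0.
Proof.
move=> y0; apply: same_eq0 (same_sym (same_assoc _ _ _)) _.
exact: (@op_comp0r _ _ _ _ _ _ ord0).
Qed.

Lemma same_restr_pair a b (y : P a) (z : P b)
    (f : pred 'I_(\sum_i pair_arity a b i)%N) :
  (forall j, f (tagnat.Rank (ord0 : 'I_2) j)) ->
  (forall j, ~~ f (tagnat.Rank (ord_max : 'I_2) j)) ->
  same (op_comp z (fun _ => one0 P)) (one0 P) ->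
  same (prestr f (op_comp (one2 P) (pair_of y z))) y.
Proof.
move=> f0 f1 z0; apply: same_trans (same_assoc _ _ _) _.
apply: same_trans (same_one2_one0 y); apply: same_comp; apply: ord2_ind.
  apply: same_trans (same_unitr y); apply: same_comp => j /=.
  by rewrite f0.
by apply: same_trans z0; apply: same_comp => j /=; rewrite (negbTE (f1 j)).
Qed.

(** An m-fold product 1_m, for some bracketing of 1_2. *)
Lemma exists_padding m :
  exists z : P m, same (op_comp z (fun _ => one0 P)) (one0 P).
Proof.
elim: m => [|m [z z0]].
  exists (one0 P); apply: same_trans (same_unitr (one0 P)).
  by apply: same_comp => -[].
have e : (\sum_i pair_arity m 1 i = m.+1)%N by rewrite sum_pair_arity addn1.
exists (opcast e (op_comp (one2 P) (pair_of z (op_id P)))).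
apply: same_trans (same_comp_cst _ (same_opcast _ _)) _.
apply: same_trans (same_assoc _ _ _) _.
apply: same_trans (same_one2_one0 (one0 P)).
by apply: same_comp; apply: ord2_ind => //=; exact: same_unitl.
Qed.

Lemma op_dim_gt0 n : locally_finite P -> (0 < op_dim P n)%N.
Proof.
move=> Pfin; have [z z0] := exists_padding n; rewrite lt0n; apply/eqP => dim0.
have [e [_ _ gen]] := op_dimP n Pfin; move: e gen; rewrite dim0 => e gen.
have [c zE] := gen z I; move: z0; rewrite zE big_ord0 => z0.
by case/eqP: (one0_neq0 P); apply: same_eq0 z0 _; rewrite op_comp0l.
Qed.

(** The product Y of y with a padding element has nonzero truncation to the
    set A of the inputs of y, and zero truncation to any other set B with j
    elements: some input of y lies outside B and y is in Upsilon^j(j).  Translating Y by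
    permutations that move each J with j elements to A produces a family
    diagonal with respect to the truncations. *)
Lemma binomial_le_op_dim j m (y : P j) : locally_finite P -> (0 < j)%N ->
  @Upsilon k P j j y -> y != 0 -> ('C(j + m, j) <= op_dim P (j + m))%N.
Proof.
move=> Pfin j0 yU yn0; have [z z0] := exists_padding m.
rewrite -(sum_pair_arity j m); set N := (\sum_i _)%N.
pose Y := op_comp (one2 P) (pair_of y z).
pose R0 (i : 'I_j) : 'I_N := tagnat.Rank (ord0 : 'I_2) i.
pose A : {set 'I_N} := [set R0 i | i : 'I_j].
have R0_inj : injective R0.
  move=> p q /(congr1 val)/eqP; rewrite /= tagnat.eq_Rank => /andP[_ /eqP].
  exact: val_inj.
have cA : #|A| = j by rewrite card_imset // card_ord.
(* Some input i0 of y is truncated, and already truncating i0 alone kills y. *)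
have outside (B : {set 'I_N}) : #|B| = j -> B != A -> prestr (mem B) Y = 0.
  move=> cB BA; apply: restr_pair_eq0.
  have [i0 i0B] : exists i0, R0 i0 \notin B.
    apply/existsP; rewrite -negb_forall; apply: contra BA => /forallP sAB.
    rewrite eq_sym eqEcard cA cB leqnn andbT.
    by apply/subsetP => _ /imsetP[i _ ->]; exact: sAB.
  have y0 : restr [set~ i0] y = 0.
    apply/truncation_eq0; move: yU; rewrite /Upsilon leqnn /=; apply.
    by rewrite cardsC1 card_ord.
  have sub : [set i | R0 i \in B] \subset [set~ i0].
    by apply/subsetP => i; rewrite !inE; apply: contraTneq => ->.
  apply: same_eq0 (restr_sub_eq0 sub y0).
  by apply: same_comp => i; rewrite inE.
(* On A itself only the padding is truncated, to 1_0. *)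
have inside : same (prestr (mem A) Y) y.
  apply: same_restr_pair z0 => i; first exact: imset_f.
  apply/imsetP => -[i' _ /(congr1 val)/eqP].
  by rewrite /= tagnat.eq_Rank.
pose T : finType := {J : {set 'I_N} | #|J| == j}.
have perm_ex (J : T) : exists s : 'S_N, s @: val J = A.
  by apply: exists_perm_imset; rewrite cA; exact/eqP/(valP J).
pose s J := projT1 (cid (perm_ex J)).
have sE J : s J @: val J = A := projT2 (cid (perm_ex J)).
have cT : #|T| = 'C(N, j).
  rewrite card_sig -[N in RHS]card_ord -card_draws cardsE.
  by apply: eq_card => I; rewrite !inE.
rewrite -cT.
apply: (@indep_le_dim _ _ _ _ _ (fun i : 'I_#|T| =>
    op_act Y (s (enum_val i))) (op_dimP N Pfin)) => // c c0 i.
have /(congr1 (restr (val (enum_val i)))) := c0.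
rewrite linear0 linear_sum (bigD1 i) //=.
rewrite [X in _ + X]big1 => [|i' ne]; last first.
  rewrite linearZ /=; apply/eqP; rewrite scaler_eq0; apply/orP; right.
  apply/eqP.
  apply/restr_act_eq0/outside.
    rewrite card_imset; last exact: perm_inj.
    exact/eqP/(valP (enum_val i)).
  rewrite -(sE (enum_val i')); apply: contra ne => /eqP/imset_inj.
  by move=> /(_ (@perm_inj _ _)) /val_inj /enum_val_inj ->.
rewrite addr0 linearZ /= => /eqP; rewrite scaler_eq0 => /orP[/eqP//|/eqP].
move=> /restr_act_eq0; rewrite sE => /(same_eq0 inside) y0.
by rewrite y0 eqxx in yn0.
Qed.

End Multiplication.

(** * The exponent is 1 or at least 2 *)

Section Dichotomy.
Variable R : realType.

Lemma exponentE (k : fieldType) (P : operad k) :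
  exponent R P = growth_rate R (op_dim P).
Proof. by []. Qed.

(** From (j + 1) C(2j + 2, j + 1) = 2 (2j + 1) C(2j, j). *)
Lemma central_binomial_ge j : (2 ^ (j + j) <= (j + j).+1 * 'C(j + j, j))%N.
Proof.
elim: j => [//|j IH].
have e1 := mul_bin_diag (j + j).+1.+1 j.
have e2 := mul_bin_diag (j + j).+1 j.
have e3 : 'C((j + j).+1, j.+1) = 'C((j + j).+1, j).
  by rewrite -bin_sub; [congr 'C(_, _); lia | lia].
rewrite /= in e1 e2; rewrite addSn addnS !expnS.
by nia.
Qed.

(** Since 2 / y > 1, the factor (2 / y)^(2j) outgrows 2j + 1. *)
Lemma central_binomial_eventually_ge (y : R) : 0 <= y < 2 ->
  exists j0, forall j, (j0 <= j)%N -> y ^+ (j + j) <= 'C(j + j, j)%:R.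
Proof.
move=> /andP[y0 y2]; have [->|yn0] := eqVneq y 0.
  exists 1%N => -[//|i] _; by rewrite addSn expr0n /= ler0n.
have {yn0}y0 : 0 < y by rewrite lt_neqAle eq_sym yn0.
(* Writing 2 / y = 1 + h allows the use of the binomial growth lemma, with
   C(2j, 1) * 2 >= 2j + 1. *)
have h0 : 0 < 2 / y - 1 by rewrite subr_gt0 ltr_pdivlMr // mul1r.
have [n0 n0P] := binomial_eventually_le_exp 1 2 h0.
exists n0.+1 => i le_i; have := n0P (i + i)%N.
rewrite bin1 addrC subrK => /(_ ltac:(lia)) le_exp.
rewrite -(ler_pM2l (_ : 0 < (2 / y) ^+ (i + i))); last first.
  by rewrite exprn_gt0 // divr_gt0.
rewrite -exprMn divfK ?gt_eqF // -natrX.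
apply: le_trans (_ : ((i + i).+1 * 'C(i + i, i))%:R <= _).
  by rewrite ler_nat central_binomial_ge.
rewrite natrM ler_wpM2r //; apply: le_trans le_exp.
by rewrite ler_nat; lia.
Qed.

Lemma two_unitary_exponent (k : fieldType) (P : two_unitary_operad k) :
  locally_finite P -> exponent_values R (exponent R P).
Proof.
move=> Pfin; rewrite exponentE.
have [[K Utriv]|Unontriv] := pselect (exists K, Upsilon_trivial_from P K.+1).
  left; apply/eqP; rewrite eq_le; apply/andP; split.
    apply: growth_rate_le => // h h0.
    have [n0 n0P] := binomial_eventually_le_exp K (op_dim P K) h0.
    exists (maxn K n0) => n; rewrite geq_max => /andP[Kn n0n].
    by apply: le_trans (n0P n n0n); rewrite ler_nat op_dim_le_binomial.
  apply: growth_rate_ge => y /andP[y0 y1] n0; exists n0 => //.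
  apply: le_trans (_ : 1 <= _); first by rewrite exprn_ile1 // ltW.
  by rewrite ler1n op_dim_gt0.
right; apply: growth_rate_ge => y y2 n0.
have [j0 j0P] := central_binomial_eventually_ge y2.
have [j [j_ge [x [xU xn0]]]] : exists j, ((maxn n0 j0).+1 <= j)%N /\
    exists x : P j, (@Upsilon k P j j) x /\ x != 0.
  apply: contrapT => none; apply: Unontriv; exists (maxn n0 j0) => j le_j x xU.
  apply/eqP; apply: contrapT => /negP xn0; apply: none.
  by exists j; split=> //; exists x.
exists (j + j)%N; first lia.
apply: le_trans (j0P j _) _; first lia.
rewrite ler_nat; apply: binomial_le_op_dim xU xn0 => //; lia.
Qed.

End Dichotomy.

(** * Operads from presheaves of commutative algebras *)

Section OperadOfPresheaf.
Variable k : fieldType.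

Definition pcomp a b c (phi : 'I_b -> option 'I_a) (psi : 'I_c -> option 'I_b)
    (p : 'I_c) : option 'I_a :=
  obind phi (psi p).

Record presheaf := Presheaf {
  ps_alg :> nat -> comAlgType k ;
  pull : forall a b,
    ('I_b -> option 'I_a) -> {lrmorphism ps_alg a -> ps_alg b} ;
  pull_id : forall n (x : ps_alg n), pull (@Some 'I_n) x = x ;
  pull_pcomp : forall a b c (phi : 'I_b -> option 'I_a)
      (psi : 'I_c -> option 'I_b) (x : ps_alg a),
    pull psi (pull phi x) = pull (pcomp phi psi) x }.

Variable A : presheaf.

Lemma eq_pull a b (phi psi : 'I_b -> option 'I_a) :
  phi =1 psi -> forall x : A a, pull A phi x = pull A psi x.
Proof. by move=> /funext ->. Qed.

Definition some_cast a b (e : a = b) (p : 'I_b) : option 'I_a :=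
  Some (cast_ord (esym e) p).

Lemma opcast_pull a b (e : a = b) (x : A a) :
  @opcast k (fun n => A n : lmodType k) a b e x = pull A (some_cast e) x.
Proof.
case: b / e; rewrite /= -[LHS]pull_id; apply: eq_pull => p.
by rewrite /some_cast cast_ord_id.
Qed.

(** The comparison of phi and psi is made on the underlying integers because
    their codomains are different types. *)
Lemma pull_reindex n (m : 'I_n -> nat) (u : forall i, A (m i)) i i' c
    (phi : 'I_c -> option 'I_(m i)) (psi : 'I_c -> option 'I_(m i')) :
  i = i' -> (forall p, omap val (phi p) = omap val (psi p)) ->
  pull A phi (u i) = pull A psi (u i').
Proof.
move=> e; subst i' => epsi; apply: eq_pull => p; move: (epsi p).
by case: (phi p) (psi p) => [x|] [y|] //= [/val_inj ->].
Qed.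

Definition presheaf_data : operad_data k :=
  @OperadData k (fun n => A n : lmodType k) 1
    (fun n x s => pull A (fun p => Some (s p)) x)
    (fun n m x u => pull A (fun p => Some (tagnat.sig1 p)) x *
                    \prod_i pull A (unrank i) (u i)).

(** Pullbacks being algebra morphisms, both sides of each axiom become products
    of pullbacks of the same elements, and the partial maps agree: this is
    [Rank_assoc] and [unrank_Rank] for associativity, and the definition of the
    block permutations for equivariance. *)
Lemma presheaf_axioms : operad_axioms presheaf_data.
Proof.
split=> /=.
- move=> n x; rewrite -[RHS]pull_id; apply: eq_pull => p; by rewrite perm1.
- move=> n x s t; rewrite pull_pcomp; apply: eq_pull => p.
  by rewrite /pcomp /= permM.
- by move=> n s a x y; rewrite linearP.
- by move=> n m a x y u; rewrite linearP mulrDl -scalerAl.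
- move=> n m x i a u v w uvw wi.
  rewrite [X in _ * X = _](bigD1 i) //= [X in a *: (_ * X)](bigD1 i) //=.
  rewrite [X in _ + _ * X](bigD1 i) //= wi linearP scalerAr -mulrDr.
  congr (_ * _).
  rewrite mulrDl scalerAl; congr (_ * _ + _ * _);
    by apply: eq_bigr => j /uvw [eu ev]; rewrite ?eu ?ev.
- move=> n x; rewrite opcast_pull rmorph1 mul1r.
  rewrite [X in pull A _ X]big_ord1 pull_pcomp.
  rewrite -[RHS]pull_id; apply: eq_pull => p; rewrite /pcomp /=.
  rewrite /some_cast /=; set q := cast_ord _ _.
  have -> : q = tagnat.Rank ord0 p.
    by apply: ord_inj; rewrite tagnat.RankEsum /= big_pred0.
  by rewrite unrankK.
- move=> n x; rewrite opcast_pull [X in _ * X]big1 => [|i _]; last first.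
    by rewrite rmorph1.
  rewrite mulr1 pull_pcomp -[RHS]pull_id; apply: eq_pull => p.
  rewrite /pcomp /= /some_cast; set q := cast_ord _ _; congr Some.
  have -> : q = tagnat.Rank p ord0.
    apply: ord_inj; rewrite tagnat.RankEsum /= addn0.
    rewrite sum1_card -[LHS](card_ord p) -!sum1_card.
    by rewrite (big_ord_widen n (fun=> 1%N)) // ltnW.
  by rewrite tagnat.Rank1K.
- move=> n m l x u v.
  rewrite opcast_pull !rmorphM !rmorph_prod /= !pull_pcomp.
  rewrite -mulrA; congr (_ * _).
    apply: eq_pull => q; congr Some.
    elim/rank_ind: q => p r; elim/rank_ind: p r => i j r.
    by rewrite !tagnat.Rank1K -Rank_assoc cast_ordK tagnat.Rank1K.
  rewrite [X in _ * X]prod_Rank.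
  rewrite -big_split /=; apply: eq_bigr => i0 _.
  rewrite rmorphM rmorph_prod /= rmorphM rmorph_prod /= !pull_pcomp.
  congr (_ * _).
    apply: eq_pull => q.
    elim/rank_ind: q => p r; elim/rank_ind: p r => i j r.
    rewrite /pcomp /= /some_cast -Rank_assoc cast_ordK Rank_assoc tagnat.Rank1K.
    have [->|ne] := eqVneq i0 i; last by rewrite !unrankN.
    by rewrite !unrankK /= tagnat.Rank1K.
  apply: eq_bigr => j0 _; rewrite !pull_pcomp; apply: eq_pull => q.
  exact: unrank_Rank.
- move=> n m x u s.
  rewrite opcast_pull !rmorphM !rmorph_prod /= !pull_pcomp; congr (_ * _).
    apply: eq_pull => p; rewrite /pcomp /some_cast /= permE /block_perm_fun.
    by rewrite cast_ordK tagnat.Rank1K.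
  rewrite [RHS](reindex_inj (@perm_inj _ s)) /=; apply: eq_bigr => i0 _.
  rewrite !pull_pcomp; apply: pull_reindex => [|p]; first by rewrite permK.
  rewrite /pcomp /some_cast /= [block_perm s m p]permE /block_perm_fun.
  rewrite cast_ordK -{1}(tagnat.sig2K p).
  have [e|ne] := eqVneq i0 (tagnat.sig1 p).
    by subst i0; rewrite !unrankK.
  by rewrite !unrankN // (inj_eq perm_inj).
- move=> n m x u t; rewrite rmorphM rmorph_prod /= !pull_pcomp; congr (_ * _).
    apply: eq_pull => p; rewrite /pcomp /= permE /sum_perm_fun.
    by rewrite tagnat.Rank1K.
  apply: eq_bigr => i0 _; rewrite !pull_pcomp; apply: eq_pull => p.
  rewrite /pcomp /= permE /sum_perm_fun.
  rewrite -[X in obind _ (unrank _ X)](tagnat.sig2K p).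
  have [e|ne] := eqVneq i0 (tagnat.sig1 p).
    by subst i0; rewrite !unrankK.
  by rewrite !unrankN.
Qed.

End OperadOfPresheaf.

Section ComObject.
Variables (k : fieldType) (A : presheaf k).
Hypothesis A0_span : forall x : A 0, exists c : k, x = c *: (1 : A 0).

Definition presheaf_operad : operad k := Operad (presheaf_axioms A).

Definition presheaf_unitary : unitary_operad k :=
  @UnitaryOperad k presheaf_operad (1 : A 0) (oner_neq0 _) A0_span.

Definition scalars n (c : k^o) : A n := (c : k)%:A.

Lemma scalars_is_linear n : linear (@scalars n).
Proof. by move=> c x y; rewrite /scalars scalerDl -scalerA. Qed.

HB.instance Definition _ n :=
  GRing.isLinear.Build k k^o (A n) _ (@scalars n) (@scalars_is_linear n).

Lemma presheaf_Com_act n (c : k) (s : 'S_n) :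
  (c%:A : A n) = pull A (fun p => Some (s p)) (c%:A).
Proof. by rewrite rmorph_alg. Qed.

Lemma presheaf_Com_comp n (m : 'I_n -> nat) (c : k) (u : 'I_n -> k) :
  (c * \prod_i u i)%:A = 
  pull A (fun p : 'I_(\sum_i m i)%N => Some (tagnat.sig1 p)) (c%:A) *
  \prod_i pull A (unrank i) ((u i)%:A).
Proof.
rewrite [LHS](rmorphM (GRing.in_alg _)) rmorph_prod rmorph_alg; congr (_ * _).
by apply: eq_bigr => i _; rewrite rmorph_alg.
Qed.

Definition presheaf_morphism : operad_morphism (Com k) presheaf_unitary :=
  @OperadMorphism k (Com k) presheaf_unitary
    (fun n => @scalars n) (scale1r _)
    (@presheaf_Com_act) (@presheaf_Com_comp).

Definition presheaf_op_Com : op_Com k :=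
  @OpCom k presheaf_unitary presheaf_morphism (scale1r _).

(** The increasing enumeration of I, as it arises from the blocks of size 0 or 1
    in the definition of truncations. *)
Definition incl n (I : {set 'I_n}) (p : 'I_#|I|) : 'I_n :=
  tagnat.sig1 (cast_ord (esym (sum_mem I)) p).

Lemma incl_inj n (I : {set 'I_n}) : injective (@incl n I).
Proof.
by move=> p q /sig1_mem_inj /cast_ord_inj.
Qed.

Lemma imset_incl n (I : {set 'I_n}) : @incl n I @: 'I_#|I| = I.
Proof.
apply/eqP; rewrite eqEcard card_imset; last exact: incl_inj.
rewrite card_ord leqnn andbT; apply/subsetP => _ /imsetP[p _ ->].
exact: sig1_mem.
Qed.

Lemma presheaf_truncation n (I : {set 'I_n}) (x : A n) :
  @truncation k presheaf_unitary n I x = pull A (fun p => Some (incl p)) x.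
Proof.
rewrite /truncation /= opcast_pull rmorphM /= pull_pcomp.
rewrite -[RHS]mulr1; congr (_ * _).
rewrite [X in pull A _ X]big1 ?rmorph1 // => i _.
have -> : one01 presheaf_unitary (i \in I) = 1 :> A (i \in I).
  by case: (i \in I).
by rewrite rmorph1.
Qed.

End ComObject.

(** * Square-zero presheaves with prescribed generators *)

Section SquareZero.
Variables (k : fieldType) (d : nat -> nat).

(** The value 1 at 0 accounts for the copy of Com. *)
Definition ngen (j : nat) : nat := if j is 0%N then 1%N else d j.

Definition entry n : finType := {J : {set 'I_n} & 'I_(ngen #|J|)}.

Definition square_zero n : Type := {ffun entry n -> k^o}.

HB.instance Definition _ n := GRing.Lmodule.on (square_zero n).

Section Arity.
Variable n : nat.
Implicit Types (f g h : square_zero n) (J : {set 'I_n}) (a : nat).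

(** Reading coefficients at arbitrary integers a, with value 0 out of range,
    avoids transporting a along the equality of two cardinals when a set is
    replaced by its image. *)
Definition coef f J a : k :=
  if insub a is Some a'
  then f (@Tagged _ J (fun J => 'I_(ngen #|J|)) a') else 0.

Definition of_coef (c : {set 'I_n} -> nat -> k) : square_zero n :=
  [ffun t : entry n => c (tag t) (tagged t : nat)].

Lemma of_coefK c J a : (a < ngen #|J|)%N -> coef (of_coef c) J a = c J a.
Proof. by move=> lt; rewrite /coef insubT /= ffunE. Qed.

Lemma coef_ext f g :
  (forall J a, (a < ngen #|J|)%N -> coef f J a = coef g J a) -> f = g.
Proof.
move=> e; apply/ffunP => -[J a]; move: (e J a (ltn_ord a)).
by rewrite /coef valK.
Qed.

Lemma coef_linear f g c J a :
  coef (c *: f + g) J a = c * coef f J a + coef g J a.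
Proof.
by rewrite /coef; case: insub => [t|]; rewrite ?ffunE // mulr0 addr0.
Qed.

Lemma coef_add f g J a : coef (f + g) J a = coef f J a + coef g J a.
Proof. by rewrite -[f]scale1r coef_linear mul1r scale1r. Qed.

Lemma coef_scale f c J a : coef (c *: f) J a = c * coef f J a.
Proof.
rewrite -[c *: f]addr0 coef_linear {2}/coef.
by case: insub => [t|]; rewrite ?ffunE addr0.
Qed.

(** The augmentation, whose kernel is the square-zero ideal. *)
Definition aug f := coef f set0 0.

Definition sz_one := of_coef (fun J _ => (J == set0)%:R).

Definition sz_mul f g := of_coef (fun J a =>
  if J == set0 then aug f * aug g else aug f * coef g J a + coef f J a * aug g).

Lemma aug_of_coef c : aug (of_coef c) = c set0 0%N.
Proof. by rewrite /aug of_coefK // cards0. Qed.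

Lemma sz_mulC : commutative sz_mul.
Proof.
move=> f g; congr of_coef; apply/funext => J; apply/funext => a.
by case: ifP => _; ring.
Qed.

Lemma sz_mulA : associative sz_mul.
Proof.
move=> f g h; apply: coef_ext => J a lt; rewrite !of_coefK // !aug_of_coef eqxx.
by case: ifP => J0; rewrite ?J0 1?mulrA //; ring.
Qed.

Lemma sz_mul1 : left_id sz_one sz_mul.
Proof.
move=> f; apply: coef_ext => J a lt; rewrite !of_coefK // !aug_of_coef eqxx.
have [J0|J0] := eqVneq J set0; last first.
  by rewrite mulr1n mul1r mulr0n mul0r addr0.
move: lt; rewrite J0 cards0 /= ltnS leqn0 => /eqP ->.
by rewrite mul1r.
Qed.

Lemma sz_mulDl : left_distributive sz_mul +%R.
Proof.
move=> f g h; apply: coef_ext => J a lt; rewrite !(coef_add, of_coefK) //.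
by rewrite /aug !coef_add; case: ifP => _; ring.
Qed.

Lemma sz_one_neq0 : sz_one != 0.
Proof.
apply/eqP => /(congr1 aug); rewrite aug_of_coef eqxx /aug /coef.
by case: insub => [t|] /eqP; rewrite ?ffunE oner_eq0.
Qed.

Lemma sz_scaleAl c f g : c *: sz_mul f g = sz_mul (c *: f) g.
Proof.
apply: coef_ext => J a lt; rewrite !(coef_scale, of_coefK) //.
by rewrite /aug !coef_scale; case: ifP => _; ring.
Qed.

End Arity.

HB.instance Definition _ n := GRing.Zmodule_isComNzRing.Build (square_zero n)
  (@sz_mulA n) (@sz_mulC n) (@sz_mul1 n) (@sz_mulDl n) (@sz_one_neq0 n).
HB.instance Definition _ n :=
  GRing.Lmodule_isLalgebra.Build k (square_zero n) (@sz_scaleAl n).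
HB.instance Definition _ n :=
  GRing.Lalgebra_isComAlgebra.Build k (square_zero n).

Lemma coef_one n (J : {set 'I_n}) i : (i < ngen #|J|)%N ->
  coef (1 : square_zero n) J i = (J == set0)%:R.
Proof. exact: of_coefK. Qed.

Lemma coef_mul n (f g : square_zero n) (J : {set 'I_n}) i : (i < ngen #|J|)%N ->
  coef (f * g) J i = if J == set0 then aug f * aug g
                     else aug f * coef g J i + coef f J i * aug g.
Proof. exact: of_coefK. Qed.

Section Pull.
Variables a b : nat.

Definition pimset (phi : 'I_b -> option 'I_a) (J : {set 'I_b}) : {set 'I_a} :=
  [set i | [exists p in J, phi p == Some i]].

(** Image and source have the same cardinal exactly when phi is defined and
    injective on J, by [card_pimset]. *)
Definition sz_pull (phi : 'I_b -> option 'I_a) (f : square_zero a) :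
    square_zero b :=
  of_coef (fun J c =>
    if #|pimset phi J| == #|J| then coef f (pimset phi J) c else 0).

Variable phi : 'I_b -> option 'I_a.

Lemma pimset0 : pimset phi set0 = set0.
Proof.
by apply/setP => i; rewrite !inE; apply/existsP => -[p]; rewrite inE.
Qed.

Lemma card_pimset J : (#|pimset phi J| <= #|J|)%N.
Proof.
rewrite -[#|pimset _ _|](card_imset _ (@Some_inj _)) .
apply: leq_trans (leq_imset_card phi J); apply/subset_leq_card/subsetP => y.
case/imsetP => i; rewrite inE => /existsP[p /andP[pJ /eqP <-]] ->.
exact: imset_f.
Qed.

Lemma sz_pull_is_linear : linear (sz_pull phi).
Proof.
move=> c f g; apply: coef_ext => J i lt; rewrite !(coef_linear, of_coefK) //.
by case: ifP; rewrite ?coef_linear // mulr0 addr0.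
Qed.

Lemma sz_pull_is_monoid_morphism : monoid_morphism (sz_pull phi).
Proof.
have aug_pull f : aug (sz_pull phi f) = aug f.
  by rewrite aug_of_coef pimset0 !cards0.
split=> [|f g]; apply: coef_ext => J i lt; rewrite of_coefK //.
  rewrite [RHS]coef_one //; have [e|ne] := eqVneq #|pimset phi J| #|J|.
    by rewrite coef_one ?e // -!cards_eq0 e.
  have [J0|//] := eqVneq J set0.
  by move: ne; rewrite J0 pimset0 !cards0 eqxx.
rewrite [RHS]coef_mul // !aug_pull !(of_coefK _ lt).
have [e|ne] := eqVneq #|pimset phi J| #|J|.
  by rewrite coef_mul ?e // -!cards_eq0 e.
have [J0|_] := eqVneq J set0.
  by move: ne; rewrite J0 pimset0 !cards0 eqxx.
by rewrite mulr0 mul0r addr0.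
Qed.

HB.instance Definition _ := GRing.isLinear.Build k (square_zero a)
  (square_zero b) _ (sz_pull phi) sz_pull_is_linear.
HB.instance Definition _ := GRing.isMonoidMorphism.Build (square_zero a)
  (square_zero b) (sz_pull phi) sz_pull_is_monoid_morphism.

End Pull.

Lemma sz_pull_id n (x : square_zero n) : sz_pull (@Some 'I_n) x = x.
Proof.
apply: coef_ext => J c lt; rewrite of_coefK //.
have -> : pimset (@Some 'I_n) J = J.
  apply/setP => i; rewrite inE; apply/existsP/idP => [|iJ].
    by move=> [p /andP[pJ /eqP[<-]]].
  by exists i; rewrite iJ eqxx.
by rewrite eqxx.
Qed.

(** The cardinals of J, of its image and of the image of that image decrease
    weakly, so the last equals the first if and only if both steps preserve the
    cardinal. *)
Lemma sz_pull_pcomp a b c (phi : 'I_b -> option 'I_a)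
    (psi : 'I_c -> option 'I_b) (x : square_zero a) :
  sz_pull psi (sz_pull phi x) = sz_pull (pcomp phi psi) x.
Proof.
apply: coef_ext => J i lt; rewrite !(of_coefK _ lt).
have -> : pimset (pcomp phi psi) J = pimset phi (pimset psi J).
  apply/setP => r; rewrite !inE; apply/existsP/existsP => -[].
    move=> p /andP[pJ]; rewrite /pcomp; case e: (psi p) => [q|] //= phiq.
    exists q; rewrite phiq andbT inE; apply/existsP; exists p.
    by rewrite pJ e eqxx.
  move=> q /andP[]; rewrite inE => /existsP[p /andP[pJ /eqP e] phiq].
  by exists p; rewrite pJ /pcomp e.
case: (eqVneq #|pimset psi J| #|J|) => e.
  by rewrite of_coefK ?e.
have lt1 : (#|pimset psi J| < #|J|)%N by rewrite ltn_neqAle e card_pimset.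
by rewrite ltn_eqF // (leq_ltn_trans (card_pimset _ _) lt1).
Qed.

Definition sz_presheaf : presheaf k :=
  @Presheaf k (fun n => square_zero n)
    (fun a b phi => sz_pull phi) sz_pull_id sz_pull_pcomp.

Lemma sz_span0 (x : sz_presheaf 0) : exists c : k, x = c *: (1 : sz_presheaf 0).
Proof.
exists (aug x); apply: coef_ext => J a lt; rewrite coef_scale of_coefK //.
have J0 : J = set0 by apply/setP => -[].
move: lt; rewrite J0 cards0 eqxx mulr1 /= ltnS leqn0 => /eqP -> //.
Qed.

Definition sz_op_Com : op_Com k := presheaf_op_Com sz_span0.

End SquareZero.

(** * Dimensions and signature of the square-zero operads *)

Section SquareZeroInvariants.
Variables (k : fieldType) (d : nat -> nat).
Local Open Scope classical_set_scope.

(** The truncation is the pullback along an injection with image I, so that its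
    coefficients are those of x at the subsets of I. *)
Lemma sz_truncation_eq0 n (I : {set 'I_n}) (x : square_zero k d n) :
  @truncation k (sz_op_Com k d) n I x = 0 <->
  forall (J : {set 'I_n}) a, J \subset I -> coef x J a = 0.
Proof.
rewrite (presheaf_truncation (sz_span0 (k := k) (d := d))).
have im (J : {set 'I_#|I|}) :
    pimset (fun p => Some (incl p)) J = @incl _ I @: J.
  apply/setP => i; rewrite inE; apply/existsP/imsetP.
    by move=> [p /andP[pJ /eqP[<-]]]; exists p.
  by move=> [p pJ ->]; exists p; rewrite pJ eqxx.
split=> [x0 J a sJI|x0]; last first.
  apply: coef_ext => J a lt; rewrite (of_coefK _ lt) im.
  rewrite card_imset ?eqxx; last exact: incl_inj.
  rewrite x0 //; last first.
    by apply/subsetP => _ /imsetP[p _ ->]; exact: sig1_mem.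
  by rewrite /coef; case: insub => [t|] //; rewrite ffunE.
have [lt|ge] := ltnP a (ngen d #|J|); last first.
  by rewrite /coef insubF // ltnNge ge.
pose J' := @incl _ I @^-1: J.
have J'E : @incl _ I @: J' = J.
  apply/setP => i; apply/imsetP/idP => [[p]|iJ]; first by rewrite inE => pJ ->.
  have : i \in @incl _ I @: 'I_#|I| by rewrite imset_incl (subsetP sJI).
  by case/imsetP => p _ e; exists p => //; rewrite inE -e.
have cJ' : #|J'| = #|J| by rewrite -[in RHS]J'E card_imset //; exact: incl_inj.
have := congr1 (fun f => coef f J' a) x0.
rewrite /= of_coefK ?cJ' // im J'E eqxx => ->.
by rewrite /coef; case: insub => [t|] //; rewrite ffunE.
Qed.

Lemma card_entry n : #|{: entry d n}| = (\sum_(j < n.+1) 'C(n, j) * ngen d j)%N.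
Proof.
have card_lt (J : {set 'I_n}) : (#|J| < n.+1)%N.
  by rewrite ltnS -[n in (_ <= n)%N]card_ord max_card.
rewrite card_tagged sumnE big_map big_enum /=.
under eq_bigr do rewrite card_ord.
rewrite (partition_big (fun J : {set 'I_n} => inord #|J| : 'I_n.+1) xpredT) //=.
apply: eq_bigr => j _; rewrite (eq_bigr (fun _ => ngen d j)) => [|J /eqP <-].
  rewrite sum_nat_const -[n in 'C(n, _)]card_ord -card_draws cardsE.
  congr (_ * _)%N; apply: eq_card => J.
  by rewrite -[LHS]/(eqn (inord #|J| : 'I_n.+1) j) inordK.
by rewrite inordK.
Qed.

Lemma sz_has_dim n :
  has_dim [set: sz_op_Com k d n] (\sum_(j < n.+1) 'C(n, j) * ngen d j).
Proof.
rewrite -card_entry -cardsT.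
have := has_dim_support k [set: entry d n]%SET.
congr (has_dim _ _); apply/seteqP; split=> // f _ t.
by rewrite in_setT.
Qed.

Lemma sz_locally_finite : locally_finite (sz_op_Com k d).
Proof. by move=> n; eexists; exact: sz_has_dim. Qed.

Lemma sz_op_dim n :
  op_dim (sz_op_Com k d) n = (\sum_(j < n.+1) 'C(n, j) * ngen d j)%N.
Proof. exact/op_dimE/sz_has_dim. Qed.

Lemma ngen_gt0 l : (0 < l)%N -> ngen d l = d l.
Proof. by case: l. Qed.

(** Every proper subset of the inputs misses some input, so by
    [sz_truncation_eq0] an element of Upsilon^l(l) is one supported on the full
    set of inputs. *)
Lemma sz_signature : has_signature (sz_op_Com k d) d.
Proof.
move=> l l0.
pose top : {set entry d l} := [set t : entry d l | tag t == [set: 'I_l]]%SET.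
have -> : d l = #|top|.
  have -> : top = (fun a => Tagged (fun J : {set 'I_l} => 'I_(ngen d #|J|)) a)
      @: 'I_(ngen d #|[set: 'I_l]%SET|).
    apply/setP => -[J a]; rewrite inE /=; apply/eqP/imsetP.
      by move=> e; subst J; exists a.
    by move=> [b _ /(congr1 tag)].
  rewrite card_imset => [|a b /eqP]; last by rewrite eq_Tagged => /eqP.
  by rewrite card_ord cardsT card_ord ngen_gt0.
have := has_dim_support k top.
congr (has_dim _ _); rewrite /Upsilon leqnn; apply/seteqP; split=> f /= fE.
  move=> I cI; apply/sz_truncation_eq0 => J a sJI.
  rewrite /coef; case: insub => // a'; apply: fE; rewrite inE /=.
  apply: contraTneq sJI => ->; apply/negP => /subset_leq_card.
  by rewrite cardsT card_ord cI; lia.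
move=> [J a]; rewrite inE /= => JT.
have [i iJ] : exists i, i \notin J.
  apply/existsP; rewrite -negb_forall; apply: contra JT => /forallP JT.
  by apply/eqP/setP => i; rewrite in_setT JT.
have cI : #|[set~ i]%SET| = l.-1 by rewrite cardsC1 card_ord.
have := proj1 (sz_truncation_eq0 [set~ i]%SET f) (fE _ cI) J a.
rewrite /coef valK; apply; apply/subsetP => i' i'J.
by rewrite !inE; apply: contraNneq iJ => <-.
Qed.

End SquareZeroInvariants.

(** * Realizing every exponent *)

Section Surjectivity.
Variables (R : realType) (k : fieldType).

(** A constant factor c is absorbed by (x / y)^n for every y < x. *)
Lemma growth_rate_eq (u : nat -> nat) (x : R) (c : nat) : 0 < x ->
  (forall n, (u n)%:R <= x ^+ n) -> (forall n, x ^+ n <= (u n * c)%:R) ->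
  growth_rate R u = x%:E.
Proof.
move=> x0 ux xu; apply/eqP; rewrite eq_le; apply/andP; split.
  apply: growth_rate_le => [|h h0]; first exact: ltW.
  exists 0%N => n _; apply: le_trans (ux n) _.
  by rewrite lerXn2r ?nnegrE ?addr_ge0 ?lerDl // ltW.
apply: growth_rate_ge => y /andP[y0 yx] n0.
have [->|yn0] := eqVneq y 0.
  by exists n0.+1 => //; rewrite expr0n /= ler0n.
have {yn0}y0 : 0 < y by rewrite lt_neqAle eq_sym yn0.
(* Writing x / y = 1 + h, the binomial growth lemma with j = 0 bounds c. *)
have h0 : 0 < x / y - 1 by rewrite subr_gt0 ltr_pdivlMr // mul1r.
have [n1 n1P] := binomial_eventually_le_exp 0 c h0.
exists (maxn n0 n1); first exact: leq_maxl.
have := n1P _ (leq_maxr n0 n1); set n := maxn n0 n1.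
rewrite bin0 mul1n addrC subrK => cle.
have c0 : (0 < c%:R :> R).
  rewrite ltr0n lt0n; apply/eqP => c00; have := xu 0%N.
  by rewrite c00 muln0 expr0 ler10.
rewrite -(ler_pM2r c0) -natrM; apply: le_trans (xu n).
rewrite -[X in _ <= X ^+ _](divfK (lt0r_neq0 y0)) exprMn mulrC.
by rewrite ler_wpM2r // exprn_ge0 // ltW.
Qed.

Lemma growth_rate_oo (u : nat -> nat) :
  (forall n, (0 < n)%N -> (n ^ n <= u n)%N) -> growth_rate R u = +oo%E.
Proof.
move=> nu; apply/eqyP => x x0; apply: growth_rate_ge => y /andP[y0 _] n0.
pose b := Num.Def.truncn y.
exists (maxn n0 b.+1); first exact: leq_maxl.
apply: le_trans (_ : (maxn n0 b.+1 ^ maxn n0 b.+1)%:R <= _); last first.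
  by rewrite ler_nat nu // leq_max orbT.
rewrite natrX lerXn2r ?nnegrE // ltW //; apply: lt_le_trans (truncnS_gt y) _.
by rewrite ler_nat leq_maxr.
Qed.

Lemma sum_binomial_exp (x : R) n :
  \sum_(j < n.+1) 'C(n, j)%:R * (x - 1) ^+ j = x ^+ n.
Proof.
rewrite -[in RHS](subrK 1 x) [in RHS]addrC exprDn; apply: eq_bigr => j _.
by rewrite expr1n mul1r mulr_natl.
Qed.

(** With d_j the integer part of (r - 1)^j one has (r - 1)^j / 2 <= d_j for
    j >= 1, because (r - 1)^j is either 0 (for r = 1) or at least 1; the
    binomial theorem sums these bounds to r^n / 2 <= dim P(n) <= r^n. *)
Lemma exists_op_Com_exponent (x : \bar R) : exponent_values R x ->
  exists P : op_Com k, locally_finite P /\ exponent R P = x.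
Proof.
move=> xv.
suff [d dE] : exists d, growth_rate R
    (fun n => \sum_(j < n.+1) 'C(n, j) * ngen d j)%N = x.
  exists (sz_op_Com k d); split; first exact: sz_locally_finite.
  rewrite exponentE -dE; congr growth_rate; apply/funext => n.
  exact: sz_op_dim.
have [->|[r xr r_val]] : x = +oo%E \/ exists2 r, x = r%:E & r = 1 \/ 2 <= r.
- case: x xv => [r| |] [] //.
  + by move=> [->]; right; exists 1 => //; left.
  + by rewrite lee_fin; right; exists r => //; right.
  + by left.
- exists (fun j => j ^ j)%N; apply: growth_rate_oo => n n0.
  rewrite big_ord_recr /= binn mul1n; case: n n0 => // n _.
  exact: leq_addl.
have r1 : 0 <= r - 1 by case: r_val => [->|]; lra.
(* For r = 1 this gives d_j = 0 when j > 0, that is Com itself. *)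
pose d j := Num.Def.truncn ((r - 1) ^+ j); exists d; rewrite xr.
have dS j : ngen d j.+1 = Num.Def.truncn ((r - 1) ^+ j.+1) by [].
have d_le j : (ngen d j)%:R <= (r - 1) ^+ j.
  case: j => [|j]; first by rewrite expr0.
  by rewrite dS truncn_le exprn_ge0.
have d_ge j : (r - 1) ^+ j <= (ngen d j * 2)%:R.
  case: j => [|j]; first by rewrite expr0 ler1n.
  case: r_val => [->|r2]; first by rewrite subrr expr0n ler0n.
  have rj : 1 <= (r - 1) ^+ j.+1 by rewrite exprn_ege1 //; lra.
  have dj : (1 <= ngen d j.+1)%N by rewrite dS truncn_gt0.
  have := truncnS_gt ((r - 1) ^+ j.+1) => /ltW/le_trans; apply.
  by rewrite ler_nat -dS; lia.
apply: (@growth_rate_eq _ r 2); first by case: r_val => [->|]; lra.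
  move=> n; rewrite -sum_binomial_exp natr_sum; apply: ler_sum => j _.
  by rewrite natrM ler_wpM2l.
move=> n; rewrite -sum_binomial_exp natrM natr_sum mulr_suml.
apply: ler_sum => j _; rewrite natrM -mulrA ler_wpM2l //.
by rewrite -natrM.
Qed.

End Surjectivity.

Theorem theorem0p8 (k : fieldType) (R : realType) :
  (forall d : nat -> nat, exists P : op_Com k, has_signature P d)
  /\
  ((forall P : op_Com k, locally_finite P ->
      exponent_values R (exponent R P))
   /\ (forall x : \bar R, exponent_values R x ->
      exists P : op_Com k, locally_finite P /\ exponent R P = x))
  /\
  ((forall P : two_unitary_operad k, locally_finite P ->
      exponent_values R (exponent R P))
   /\ (forall x : \bar R, exponent_values R x ->
      exists P : two_unitary_operad k, locally_finite P /\ exponent R P = x)).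
Proof.
split; first by move=> d; exists (sz_op_Com k d); exact: sz_signature.
split; split.
- move=> P; exact: (@two_unitary_exponent R k (op_Com_two_unitary P)).
- exact: exists_op_Com_exponent.
- exact: two_unitary_exponent.
- move=> x /(exists_op_Com_exponent k)[P PE].
  by exists (op_Com_two_unitary P).
Qed.
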